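(* Let $\alpha,\beta,t_0$ be real numbers with $\beta\ge0$, $t_0>0$, let $u_0,v_0\in\mathcal{H}$, and let $x:[t_0,+\infty)\to\mathcal{H}$ be the unique global $C^2$-solution of $$\ddot{x}(t)+\frac{\alpha}{t}\dot{x}(t)+\beta\nabla^2 g(x(t))\dot{x}(t)+\nabla g(x(t))+\epsilon(t)x(t)=0\quad (t\ge t_0),\qquad x(t_0)=u_0,\ \dot{x}(t_0)=v_0.$$ Assume that $\int_{t_0}^{+\infty}t\,\epsilon(t)\,dt<+\infty$ and that one of the following conditions is fulfilled: (a) there exist $a>1$ and $t_1\ge t_0$ such that $\dot{\epsilon}(t)\le-\frac{a\beta}{2}\epsilon^2(t)$ for every $t\ge t_1$; (b) there exist $a>0$ and $t_1\ge t_0$ such that $\epsilon(t)\le\frac{a}{t}$ for every $t\ge t_1$. If $\alpha>3$, then $x(t)$ converges weakly to an element of $\operatorname{argmin} g$ as $t\to+\infty$.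
   Context: $\mathcal{H}$ is a real Hilbert space. Standing assumptions: $g:\mathcal{H}\to\mathbb{R}$ is convex and twice Fréchet differentiable, its gradient $\nabla g$ is Lipschitz continuous on bounded sets, and $\operatorname{argmin} g\ne\emptyset$; $\epsilon:[t_0,+\infty)\to[0,+\infty)$ is nonincreasing, of class $C^1$, with $\lim_{t\to+\infty}\epsilon(t)=0$. *)

(* Defs.v *)
From HB Require Import structures.
From mathcomp Require Import all_boot all_order all_algebra.
From mathcomp Require Import sesquilinear.
From mathcomp Require Import all_classical all_reals all_analysis.

Set Implicit Arguments.
Unset Strict Implicit.
Unset Printing Implicit Defensive.

Import Order.TTheory GRing.Theory Num.Theory.
Import numFieldNormedType.Exports.

Local Open Scope classical_set_scope.
Local Open Scope ring_scope.

(* A real Hilbert space is a complete normed module [H] over [R : realType]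
   together with a positive definite symmetric bilinear form
   [dot : {dot H for idfun}] that induces the norm of [H]. *)
Definition induces_norm (R : realType) (H : normedModType R)
    (dot : {dot H for idfun}) :=
  forall x : H, dot x x = `|x| ^+ 2.

(* Defined by choice: the Riesz representative of ['d g x], and the junk value
   [0] if there is none. *)
Definition gradient (R : realType) (H : normedModType R)
    (dot : {dot H for idfun}) (g : H -> R) (x : H) : H :=
  xget 0 [set y | forall h, 'd g x h = dot y h].

(* The Riesz isomorphism identifies the second derivative of [g] with the
   derivative of its gradient. *)
Definition twice_differentiable (R : realType) (H : normedModType R)
    (dot : {dot H for idfun}) (g : H -> R) :=
  (forall x, differentiable g x) /\
  (forall x, differentiable (gradient dot g) x).

Definition hessian (R : realType) (H : normedModType R)
    (dot : {dot H for idfun}) (g : H -> R) (x : H) : {linear H -> H} :=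
  'd (gradient dot g) x.

Definition lipschitz_on_bounded (R : realType) (V W : normedModType R)
    (f : V -> W) :=
  forall B : set V, bounded_set B -> [lipschitz f x | x in B].

Definition argmin (R : realType) (T : Type) (g : T -> R) : set T :=
  [set x | forall y, g x <= g y].

(* The limit of difference quotients is taken inside [D], so that at an
   endpoint of an interval [D] it is the one-sided derivative; values of [f]
   outside [D] are irrelevant for the derivative at a point of [D]. *)
Definition quotient_within (R : realType) (V : normedModType R) (D : set R)
    (f : R -> V) (t : R) : set_system V :=
  (s - t)^-1 *: (f s - f t) @[s --> within D t^'].

Definition derivable_within (R : realType) (V : normedModType R) (D : set R)
    (f : R -> V) :=
  forall t, D t -> cvg (quotient_within D f t).

Definition derive_within (R : realType) (V : normedModType R) (D : set R)
    (f : R -> V) (t : R) : V :=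
  lim (quotient_within D f t).

Definition C1_on (R : realType) (V : normedModType R) (D : set R)
    (f : R -> V) :=
  derivable_within D f /\ {within D, continuous (derive_within D f)}.

Definition C2_on (R : realType) (V : normedModType R) (D : set R)
    (f : R -> V) :=
  derivable_within D f /\ C1_on D (derive_within D f).

Definition is_C2_solution (R : realType) (H : normedModType R)
    (dot : {dot H for idfun}) (g : H -> R) (eps : R -> R)
    (alpha beta t0 : R) (u0 v0 : H) (x : R -> H) :=
  let D := [set` `[t0, +oo[] in
  let x' := derive_within D x in
  let x'' := derive_within D x' in
  [/\ C2_on D x,
      forall t, t0 <= t ->
        x'' t + (alpha / t) *: x' t + beta *: hessian dot g (x t) (x' t)
          + gradient dot g (x t) + eps t *: x t = 0,
      x t0 = u0
    & x' t0 = v0].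

Definition weakly_cvg (R : realType) (H : normedModType R)
    (dot : {dot H for idfun}) (F : set_system H) (l : H) :=
  forall y : H, dot z y @[z --> F] --> dot l y.

(* Main.v *)
Require Import Defs.
From HB Require Import structures.
From mathcomp Require Import all_boot all_order all_algebra.
From mathcomp Require Import sesquilinear.
From mathcomp Require Import all_classical all_reals all_analysis.
From mathcomp Require Import measurable_realfun ring lra.

Import Order.TTheory GRing.Theory Num.Theory.
Import numFieldNormedType.Exports.

Local Open Scope classical_set_scope.
Local Open Scope ring_scope.

(* Let [z] minimize [g], [y = x' + beta * grad g(x)], [G = g(x) - g(z)], and for
   [2 < b < alpha - 1] consider the energy
     [(t^2 + (alpha - 2 - b) beta t) G + t^2 eps(t) |x|^2 / 2
       + |b (x - z) + t y|^2 / 2 + b (alpha - 1 - b) |x - z|^2 / 2].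
   As [eps] is nonincreasing and [t eps(t)] is integrable, [eps(t) = O(1/t^2)],
   and the derivative of the energy is at most
   [K t eps(t) - c t <grad g(x), x - z>] for large [t], with [c > 0]. So the
   energy converges, [t^2 G] is bounded and [g(x(t))] tends to [g(z)]. The
   energy is affine in [b]; subtracting two of them shows that, for
   [h = |x - z|^2 / 2] and some [L],
     [(alpha - 1) h + t h' + beta t <grad g(x), x - z> --> L],
   whence [h --> L / (alpha - 1)]: the last summand is nonnegative, and the
   dissipation of the energy absorbs it. Opial's lemma concludes. *)

(** * Hilbert space geometry *)

Section inner_product.
Context {R : realType} {H : normedModType R} {dot : {dot H for idfun}}.

Lemma dotC u v : dot u v = dot v u.
Proof. by rewrite (hermC dot) /= expr0 mul1r. Qed.

Lemma dotDl u v w : dot (u + v) w = dot u w + dot v w.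
Proof. exact: linearDl. Qed.

Lemma dotDr u v w : dot w (u + v) = dot w u + dot w v.
Proof. exact: linearDr. Qed.

Lemma dotZl a u w : dot (a *: u) w = a * dot u w.
Proof. exact: linearZl_LR. Qed.

Lemma dotZr a u w : dot w (a *: u) = a * dot w u.
Proof. by rewrite dotC dotZl dotC. Qed.

Lemma dotNl u w : dot (- u) w = - dot u w.
Proof. exact: linearNl. Qed.

Lemma dotNr u w : dot w (- u) = - dot w u.
Proof. exact: linearNr. Qed.

Lemma dotBl u v w : dot (u - v) w = dot u w - dot v w.
Proof. by rewrite dotDl dotNl. Qed.

Lemma dotBr u v w : dot w (u - v) = dot w u - dot w v.
Proof. by rewrite dotDr dotNr. Qed.

Lemma dot0l w : dot 0 w = 0.
Proof. exact: linear0l. Qed.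

Definition dotE := (dotDl, dotDr, dotNl, dotNr, dotZl, dotZr).

Hypothesis hdot : induces_norm dot.

Lemma dot_ge0 u : 0 <= dot u u.
Proof. by rewrite hdot exprn_ge0. Qed.

(** Positivity of the square of [|v|^2 u - <u, v> v], which equals [|v|^2 (|u|^2 |v|^2 - <u, v>^2)],
    after cancelling [|v|^2 > 0]. *)
Lemma cauchy_schwarz u v : `|dot u v| <= `|u| * `|v|.
Proof.
have [->|v0] := eqVneq v 0.
  by rewrite dotC dot0l normr0 mulr_ge0.
have vpos : 0 < `|v| ^+ 2 by rewrite exprn_gt0 // normr_gt0.
rewrite -ler_sqr ?nnegrE ?mulr_ge0 // exprMn -normrX ger0_norm ?sqr_ge0 //.
have := dot_ge0 (`|v| ^+ 2 *: u - dot u v *: v).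
rewrite !dotE !hdot (dotC v u).
set c := dot u v; set a := `|u| ^+ 2; set b := `|v| ^+ 2 => h.
suff : 0 <= b * (a * b - c ^+ 2) by rewrite (pmulr_rge0 _ vpos) subr_ge0.
by move: h; congr (0 <= _); ring.
Qed.

(** Expresses the inner product through the norm alone, so that its joint continuity follows from
    that of the norm. *)
Lemma dot_polarization u v :
  dot u v = 4^-1 * (`|u + v| ^+ 2 - `|u - v| ^+ 2).
Proof. by rewrite -!hdot !dotE (dotC v u); field. Qed.

Lemma cvg_dot T (F : set_system T) {FF : Filter F} (f g : T -> H) a b :
  f @ F --> a -> g @ F --> b -> dot (f t) (g t) @[t --> F] --> dot a b.
Proof.
move=> fa gb; rewrite dot_polarization.
under eq_fun do rewrite dot_polarization.
apply: cvgM; first exact: cvg_cst.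
apply: cvgB; rewrite expr2; under eq_fun do rewrite expr2.
- by apply: cvgM; apply: cvg_norm; apply: cvgD.
- by apply: cvgM; apply: cvg_norm; apply: cvgB.
Qed.

(** The difference quotient splits into [<(f(t + k) - f(t)) / k, h(t + k)>] and
    [<f(t), (h(t + k) - h(t)) / k>]; the first part needs the continuity of [h] at [t]. *)
Lemma is_derive_dot (f h : R -> H) (t : R) (df dh : H) :
  is_derive t 1 f df -> is_derive t 1 h dh ->
  is_derive t 1 (fun s => dot (f s) (h s)) (dot df (h t) + dot (f t) dh).
Proof.
move=> [fd fv] [hd hv].
have hc : h (k + t) @[k --> 0^'] --> h t.
  have /differentiable_continuous : differentiable h t by exact/derivable1_diffP.
  move=> hc.
  have -> : h t = h (0 + t) by rewrite add0r.
  apply: cvg_trans; first exact: (cvg_app _ (@nbhs_dnbhs _ (0 : R))).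
  apply: (@cvg_comp _ _ _ (fun k => k + t) h _ (nbhs (0 + t))).
    by apply: cvgD; [exact: cvg_id|exact: cvg_cst].
  by rewrite add0r.
have q : (fun k => k^-1 *:
    (dot (f (k *: 1 + t)) (h (k *: 1 + t)) - dot (f t) (h t))) @ 0^'
    --> dot df (h t) + dot (f t) dh.
  under eq_fun => k.
    rewrite (_ : _ *: _ = dot (k^-1 *: (f (k *: 1 + t) - f t)) (h (k + t))
       + dot (f t) (k^-1 *: (h (k *: 1 + t) - h t))); last first.
      by rewrite !dotE /GRing.scale /= !mulr1; ring.
    over.
  apply: cvgD; apply: cvg_dot => //; first by rewrite -fv; exact: fd.
  - exact: cvg_cst.
  - by rewrite -hv; exact: hd.
split; last exact: cvg_lim.
by apply/cvg_ex; exists (dot df (h t) + dot (f t) dh).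
Qed.

Lemma parallelogram (u v : H) :
  `|u - v| ^+ 2 = 2 * `|u| ^+ 2 + 2 * `|v| ^+ 2 - `|u + v| ^+ 2.
Proof. by rewrite -!hdot !dotE; ring. Qed.

End inner_product.

(** * Riesz representation and the gradient *)

Section riesz.
Context {R : realType} {H : completeNormedModType R} {dot : {dot H for idfun}}.
Hypothesis hdot : induces_norm dot.

(* The representative is the minimizer of [y |-> `|y| ^+ 2 / 2 - l y]; by the
   parallelogram identity the minimizing filter is Cauchy. *)
Lemma riesz (l : H -> R) (M : R) :
  {morph l : u v / u + v} -> (forall a u, l (a *: u) = a * l u) ->
  (forall u, `|l u| <= M * `|u|) ->
  exists c, forall u, l u = dot c u.
Proof.
move=> lD lZ lM; pose J y := `|y| ^+ 2 / 2 - l y.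
have lN u : l (- u) = - l u by rewrite -scaleN1r lZ mulN1r.
pose m := inf (range J).
have hJ : has_inf (range J).
  split; first by exists (J 0), 0.
  exists (- (M ^+ 2 / 2)) => _ [y _ <-].
  have := lM y; have := ler_norm (l y); rewrite /J.
  by have := sqr_ge0 (`|y| - M); nra.
have mJ y : m <= J y by apply: ge_inf; [exact: hJ.2|exists y].
have Jm e : 0 < e -> exists y, J y < m + e.
  by move=> e0; have [_ [y _ <-] ?] := inf_adherent e0 hJ; exists y.
have Jd e u v : J u < m + e -> J v < m + e -> `|u - v| ^+ 2 < 8 * e.
  move=> Ju Jv; have := mJ (2^-1 *: (u + v)).
  rewrite /J in Ju Jv *; rewrite normrZ lZ lD exprMn ger0_norm ?invr_ge0 //.
  rewrite (parallelogram hdot) => h; lra.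
pose F := filter_from [set e : R | 0 < e] (fun e => [set y | J y < m + e]).
have FF : ProperFilter F.
  apply: filter_from_proper => [|e /Jm //].
  apply: filter_from_filter; first by exists 1 => /=.
  move=> i j i0 j0; exists (Num.min i j) => /=; first by rewrite lt_min i0.
  by move=> y /=; rewrite -ltrBlDl lt_min !ltrBlDl => /andP[].
have Fc : cauchy F.
  apply: cauchy_exP => e e0.
  have d0 : 0 < e ^+ 2 / 8 by rewrite divr_gt0 ?exprn_gt0.
  have [u Ju] := Jm _ d0; exists u, (e ^+ 2 / 8) => // v /= Jv.
  rewrite -ball_normE /= -ltr_sqr ?nnegrE ?(ltW e0) //.
  by rewrite (lt_le_trans (Jd _ _ _ Ju Jv)) // mulrC divfK.
have Fcc := cauchy_cvg F Fc; set c := lim F in Fcc.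
exists c => u.
have lc : l y @[y --> F] --> l c.
  apply/cvgrPdist_le => e e0.
  have d0 : 0 < e / (`|M| + 1) by rewrite divr_gt0 // ltr_wpDl.
  have /cvgrPdist_lt/(_ _ d0) : y @[y --> F] --> c by exact: Fcc.
  apply: filterS => y.
  rewrite ltr_pdivlMr ?ltr_wpDl // => h.
  rewrite -lN -lD (le_trans (lM _)) //.
  by have := ler_norm M; have := normr_ge0 (c - y); nra.
have Jc : J c <= m.
  have Jl : J y @[y --> F] --> J c.
    apply: cvgB => //; apply: cvgM; last exact: cvg_cst.
    rewrite expr2; under eq_fun do rewrite expr2.
    by apply: cvgM; apply: cvg_norm; exact: Fcc.
  apply/ler_addgt0Pr => e e0; apply: (cvgr_to_le Jl).
  by exists e => // y /= /ltW.
have [->|u0] := eqVneq u 0.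
  by rewrite dotC dot0l -(subrr 0) lD lN subrr.
have up : 0 < `|u| ^+ 2 by rewrite exprn_gt0 // normr_gt0.
(* Minimality is tested along [u], at the step length that minimizes [J] on that line; the gain is
   [d^2 / (2 |u|^2)], which forces [d = 0]. *)
have := le_trans Jc (mJ (c + (l u - dot c u) / `|u| ^+ 2 *: u)).
rewrite /J lD lZ -!hdot !dotE (dotC u c) !hdot.
set d := l u - dot c u => h.
have : d ^+ 2 / `|u| ^+ 2 <= 0.
  have : 0 <= - (d ^+ 2 / `|u| ^+ 2) / 2.
    rewrite -subr_ge0 in h; move: h; congr (0 <= _).
    have -> : dot c u = l u - d by rewrite /d subKr.
    by field; rewrite normr_eq0.
  lra.
rewrite pmulr_lle0 ?invr_gt0 // => d0; apply/eqP.
by rewrite -subr_eq0 -sqrf_eq0 eq_le d0 sqr_ge0.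
Qed.

(** The differential is a bounded linear form, so Riesz gives a representative and the choice in
    [gradient] does not fall back on its default value. *)
Lemma dot_gradient (g : H -> R) x : differentiable g x ->
  forall h, 'd g x h = dot (gradient dot g x) h.
Proof.
move=> gx; suff [c hc] : exists c, forall u, 'd g x u = dot c u.
  exact: (@xgetI _ 0 [set y | forall h, 'd g x h = dot y h] c).
have dc : {for 0, continuous ('d g x)} by exact: diff_continuous.
have /linear_boundedP/pinfty_ex_gt0[M M0 hM] := continuous_linear_bounded 0 dc.
by apply: (riesz _ M) => [u v|a u|u]; [exact: linearD|exact: linearZ|exact: hM].
Qed.

End riesz.

(** * Weak convergence *)

Section weak_convergence.
Context {R : realType} {H : completeNormedModType R} {dot : {dot H for idfun}}.
Hypothesis hdot : induces_norm dot.

(** Weak compactness of balls in ultrafilter form: each [<x t, y>] stays in a compact segment and so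
    converges along [U]; the limit is a bounded linear form in [y], which Riesz represents by some
    [z]. *)
Lemma ultra_weakly_cvg (T : Type) (U : set_system T) (UU : UltraFilter U)
    (x : T -> H) (M : R) :
  (\forall t \near U, `|x t| <= M) ->
  exists z, weakly_cvg dot (x t @[t --> U]) z.
Proof.
move=> xM.
have cv y : cvg (dot (x t) y @[t --> U]).
  have := @segment_compact R (- (M * `|y|)) (M * `|y|); rewrite compact_ultra.
  have UF : UltraFilter (dot (x t) y @[t --> U]).
    split; first exact: fmap_proper_filter.
    move=> G GF sG; apply/seteqP; split => // A GA.
    rewrite /fmap /=.
    have [//|UA] := in_ultra_setVsetC ((fun t => dot (x t) y) @^-1` A) UU.
    have GC : G (~` A) by apply: sG.
    have := filter_ex (filterI GA GC); case => r [] //.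
  move=> /(_ _ UF) [|l [_ lU]]; last by apply/cvg_ex; exists l.
  apply: filterS xM => t xt /=; rewrite in_itv /= -ler_norml.
  by rewrite (le_trans (cauchy_schwarz hdot _ _)) // ler_wpM2r.
pose l y := lim (dot (x t) y @[t --> U]).
have [z lz] : exists z, forall y, l y = dot z y.
  apply: (riesz hdot l M).
  - move=> u v; apply: cvg_lim => //; under eq_fun do rewrite dotDr.
    by apply: cvgD; exact: cv.
  - move=> a u; apply: cvg_lim => //; under eq_fun do rewrite dotZr.
    by apply: cvgM; [exact: cvg_cst|exact: cv].
  - move=> u; have ln : `|dot (x t) u| @[t --> U] --> `|l u|.
      by apply: cvg_norm; exact: cv.
    apply: (cvgr_to_le ln); apply: filterS xM => t xt.
    by rewrite (le_trans (cauchy_schwarz hdot _ _)) // ler_wpM2r.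
by exists z => y; rewrite -lz; exact: cv.
Qed.

(** Convexity bounds the difference quotients of [g] at [x] in the direction [y - x], with step in
    []0, 1]], by [g y - g x]; the bound passes to the limit. *)
Lemma convex_gradient_le (g : H -> R) :
  convex_function [set: H] g -> (forall x, differentiable g x) ->
  forall x y, g x + dot (gradient dot g x) (y - x) <= g y.
Proof.
move=> gc gd x y; rewrite -(dot_gradient hdot) // -deriveE //.
have dg : derivable g x (y - x) by exact: diff_derivable.
have dl := cvg_dnbhs_at_right dg.
rewrite -lerBrDl; apply: (cvgr_to_le dl).
near=> h => /=.
have h0 : 0 < h by near: h; exact: nbhs_right_gt.
have h1 : h <= 1 by near: h; exact: nbhs_right_le.
rewrite /GRing.scale /= ler_pdivrMl //.
have gh : g (h *: (y - x) + x) <= h * g y + (1 - h) * g x.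
  have := gc (Itv01 (ltW h0) h1) y x (in_setT _) (in_setT _).
  congr (g _ <= _).
  rewrite -[LHS]/(h *: y + (1 - h) *: x).
  by rewrite scalerBr scalerBl scale1r addrAC addrA.
by rewrite lerBlDr (le_trans gh) //; lra.
Unshelve. all: by end_near. Qed.

(** Weak limits along ultrafilters finer than [F] exist and lie in [S]. Two of them, [u] and [v],
    agree: [<x t, u - v>] is a combination of [|x t - u|^2], [|x t - v|^2] and constants, so it has
    one limit along [F], whence [<u, u - v> = <v, u - v>]. *)
Lemma opial (T : Type) (F : set_system T) (FF : ProperFilter F) (x : T -> H)
    (S : set H) :
  S !=set0 ->
  (forall z, S z -> cvg (`|x t - z| @[t --> F])) ->
  (forall U : set_system T, UltraFilter U -> F `<=` U ->
    forall z, weakly_cvg dot (x t @[t --> U]) z -> S z) ->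
  exists2 z, S z & weakly_cvg dot (x t @[t --> F]) z.
Proof.
move=> [z0 Sz0] xS US.
have [M xM] : exists M, \forall t \near F, `|x t| <= M.
  have /cvg_ex[l /cvgrPdist_lt /(_ _ ltr01) hl] := xS _ Sz0.
  exists (l + 1 + `|z0|); apply: filterS hl => t hl.
  rewrite -lerBlDr (le_trans (lerB_dist _ _)) //.
  by move: hl; rewrite ltr_distlC => /andP[]; lra.
have ex_lim U : UltraFilter U -> F `<=` U ->
    exists2 z, S z & weakly_cvg dot (x t @[t --> U]) z.
  move=> UU FU; have [|z hz] := @ultra_weakly_cvg _ U UU x M; first exact: FU.
  by exists z => //; exact: US hz.
have uniq U V u v : UltraFilter U -> UltraFilter V -> F `<=` U -> F `<=` V ->
    S u -> S v -> weakly_cvg dot (x t @[t --> U]) u ->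
    weakly_cvg dot (x t @[t --> V]) v -> u = v.
  move=> UU VV FU FV Su Sv xu xv.
  have cuv : cvg (dot (x t) (u - v) @[t --> F]).
    have -> : (fun t => dot (x t) (u - v)) = (fun t => 2^-1 *
        (`|x t - v| * `|x t - v| - `|x t - u| * `|x t - u|
          + dot u u - dot v v)).
      apply/funext => t; rewrite -!expr2 -!hdot !dotE.
      by rewrite (dotC v (x t)) (dotC u (x t)); field.
    have := xS _ Su; have := xS _ Sv.
    move=> /cvg_ex[a ha] /cvg_ex[b hb].
    apply: is_cvgM; first exact: is_cvg_cst.
    apply: is_cvgB; last exact: is_cvg_cst.
    apply: is_cvgD; last exact: is_cvg_cst.
    by apply: is_cvgB; apply: is_cvgM; apply/cvg_ex;
      [exists a..|exists b|exists b].
  move/cvg_ex : cuv => [l hl].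
  have lu : l = dot u (u - v).
    by apply: (@cvg_unique _ _ (dot (x t) (u - v) @[t --> U])) => //;
      [apply: cvg_trans hl; exact: cvg_app|exact: xu].
  have lv : l = dot v (u - v).
    by apply: (@cvg_unique _ _ (dot (x t) (u - v) @[t --> V])) => //;
      [apply: cvg_trans hl; exact: cvg_app|exact: xv].
  apply/eqP; rewrite -subr_eq0 -normr_eq0 -sqrf_eq0 -hdot dotBl -lu -lv.
  by rewrite subrr.
have [U0 [UU0 FU0]] := ultraFilterLemma FF.
have [z Sz xz] := ex_lim U0 UU0 FU0.
exists z => // y; apply/cvgrPdist_lt => e e0.
(* If [A] were not in [F], then [F] restricted to the complement of [A] would be proper; an
   ultrafilter above it would have the same weak limit [z], and would contain both [A] and its
   complement. *)
pose A := [set t | `|dot z y - dot (x t) y| < e].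
have [//|nFA] := pselect (F A).
have PG : ProperFilter (within (~` A) F).
  apply: Build_ProperFilter => //.
  rewrite /within /= => FA; apply: nFA.
  by apply: filterS FA => t /= h; apply: contrapT => /h.
have [V [VV FV]] := ultraFilterLemma PG.
have FV' : F `<=` V by apply: subset_trans FV; exact: cvg_within.
have [v Sv xv] := ex_lim V VV FV'.
have zv := uniq _ _ _ _ UU0 VV FU0 FV' Sz Sv xz xv.
have VA : V A.
  by have := xv y => /cvgrPdist_lt/(_ _ e0); rewrite /A zv.
have VnA : V (~` A) by apply: FV; exact: withinT.
have PV : ProperFilter V := @ultra_proper _ _ VV.
by have [t []] : A `&` ~` A !=set0 by apply: (@filter_ex _ V); exact: filterI.
Qed.

End weak_convergence.

(** * Real functions on a half-line *)

(** For [t > t0] the half-line is a neighbourhood of [t], so the quotient filter inside it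
    coincides, after a shift by [t], with that of the ordinary derivative. *)
Lemma is_derive_within (R : realType) (V : normedModType R) (t0 t : R)
    (f : R -> V) :
  derivable_within [set` `[t0, +oo[] f -> t0 < t ->
  is_derive t 1 f (derive_within [set` `[t0, +oo[] f t).
Proof.
move=> fd t0t.
have Dt : [set` `[t0, +oo[] t by rewrite /= in_itv /= andbT ltW.
have fE : quotient_within [set` `[t0, +oo[] f t =
    h^-1 *: ((f \o shift t) (h *: 1) - f t) @[h --> 0^'].
  have nD : \forall s \near t, [set` `[t0, +oo[] s.
    by apply: filterS (lt_nbhsr t0t) => s; rewrite /= in_itv /= andbT => /ltW.
  apply/funext => A; rewrite /quotient_within /fmap /within /= /dnbhs /within /=.
  have nD0 : \forall h \near 0, [set` `[t0, +oo[] (h + t).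
    by move: nD; rewrite (near_shift 0 t) subr0.
  rewrite [LHS](near_shift 0 t) subr0; apply/propext; split=> hA.
    apply: filterS2 nD0 hA => h Dh /=.
    rewrite addrK [h%:A]mulr1 => hA h0; apply: hA => //.
    by rewrite -subr_eq0 addrK.
  have {}hA : \forall h \near 0, h != 0 ->
    A (h^-1 *: (f (h *: 1 + t) - f t)) := hA.
  apply: filterS hA => h /=; rewrite addrK [h%:A]mulr1 => hA h0 _; apply: hA.
  by move: h0; rewrite -subr_eq0 addrK.
have := fd _ Dt; rewrite /derive_within fE => fdt.
by split.
Qed.


Section half_line.
Context {R : realType}.
Implicit Types (f df : R -> R) (T : R).

Lemma is_derive_mvt f df T s t : 
  (forall r, T < r -> is_derive r 1 f (df r)) -> T < s -> s <= t ->
  exists2 r, T < r /\ s <= r <= t & f t - f s = df r * (t - s).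
Proof.
move=> fd Ts st.
have [r rst e] : exists2 r, r \in `[s, t]%R & f t - f s = df r * (t - s).
  apply: MVT_segment => // [r /[!in_itv] /= /andP[sr _]|].
    by apply: fd; exact: lt_trans sr.
  apply: derivable_within_continuous => r /[!in_itv] /= /andP[sr _].
  by have [] := fd r (lt_le_trans Ts sr).
exists r => //; move: rst; rewrite in_itv /= => /andP[sr rt].
by rewrite sr rt (lt_le_trans Ts).
Qed.

Lemma is_derive_le0 f df T :
  (forall r, T < r -> is_derive r 1 f (df r)) ->
  (forall r, T < r -> df r <= 0) ->
  forall s t, T < s -> s <= t -> f t <= f s.
Proof.
move=> fd d0 s t Ts st; have [r [Tr _] e] := is_derive_mvt _ _ _ _ _ fd Ts st.
by rewrite -subr_le0 e mulr_le0_ge0 ?d0 // subr_ge0.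
Qed.

Lemma nonincreasing_near_cvgr f T (m : R) :
  (forall s t, T < s -> s <= t -> f t <= f s) ->
  (forall t, T < t -> m <= f t) ->
  cvg (f t @[t --> +oo]).
Proof.
(* Freezing [f] to the left of [T + 1] and changing its sign gives a function that is nondecreasing
   on the whole line. *)
move=> fT mf; pose h t := - f (Num.max t (T + 1)).
have hT t : T < Num.max t (T + 1) by rewrite lt_max ltrDl ltr01 orbT.
have hc : cvg (h t @[t --> +oo]).
  apply/cvg_ex; exists (sup (range h)); apply: nondecreasing_cvgr.
    move=> s t st; rewrite lerN2 fT // ge_max !le_max st /= lexx orbT //.
  by exists (- m) => _ [t _ <-]; rewrite lerN2 mf.
move/cvg_ex : hc => [l /cvgN hl].
apply/cvg_ex; exists (- l); apply: cvg_trans hl; apply: near_eq_cvg.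
near=> t; have Tt : T + 1 <= t.
  by near: t; apply: nbhs_pinfty_ge; rewrite num_real.
by rewrite /h /= opprK max_l.
Unshelve. all: by end_near. Qed.

(* The inequality makes [t `^ c * (m t - L / c + e / 2)] eventually
   nondecreasing. *)
Lemma cvg_euler_ge (m dm r : R -> R) (T c L e : R) : 1 <= c -> 0 < e ->
  (forall t, T < t -> is_derive t 1 m (dm t)) ->
  (forall t, T < t -> r t <= c * m t + t * dm t) ->
  r t @[t --> +oo] --> L ->
  \forall t \near +oo, L / c - e <= m t.
Proof.
move=> c1 e0 md mr rL; have c0 : 0 < c by exact: lt_le_trans c1.
have [T1 [T1T T10 rT1]] : exists T1, [/\ T <= T1, 0 < T1 &
    forall t, T1 < t -> L - c * e / 2 <= r t].
  (* With this tolerance, [c (m - L / c + e / 2) + t m' >= r - L + c e / 2 >= 0], which is the sign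
     needed for the monotonicity of [n]. *)
  have d0 : 0 < c * e / 2 by rewrite divr_gt0 // mulr_gt0.
  have /cvgrPdist_le/(_ _ d0)[A [_ hA]] := rL.
  exists (Num.max (Num.max T A) 1); split.
  - by rewrite !le_max lexx.
  - by rewrite lt_max ltr01 orbT.
  - move=> t; rewrite !gt_max => /andP[/andP[_ /hA + _]].
    by rewrite ler_distlC => /andP[].
pose n t := - (t `^ c * (m t - L / c + e / 2)).
pose dn t := - (c * t `^ (c - 1) * (m t - L / c + e / 2) + t `^ c * dm t).
have nd t : T1 < t -> is_derive t 1 n (dn t).
  move=> T1t; have t0 : 0 < t by exact: lt_trans T1t.
  have dP : is_derive t 1 (fun s : R => s `^ c) (c * t `^ (c - 1)).
    exact: is_derive1_powR.
  have dm' := md _ (le_lt_trans T1T T1t).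
  rewrite /n; apply: is_derive_eq.
  by rewrite /dn /GRing.scale /=; ring.
have ndec : forall s t, T1 < s -> s <= t -> n t <= n s.
  apply: (is_derive_le0 _ _ _ nd) => t T1t; rewrite /dn oppr_le0.
  have t0 : 0 < t by exact: lt_trans T1t.
  rewrite -(mulr_powRB1 (ltW t0) c0).
  rewrite [leRHS](_ : _ =
    t `^ (c - 1) * (c * (m t - L / c + e / 2) + t * dm t)); last by ring.
  rewrite mulr_ge0 ?powR_ge0 //.
  have := le_trans (rT1 _ T1t) (mr _ (le_lt_trans T1T T1t)).
  have -> : L = c * (L / c) by rewrite mulrC divfK ?gt_eqF.
  by rewrite [c * (L / c) / c]mulrAC mulfV ?gt_eqF // mul1r; nra.
have Ts : T1 < T1 + 1 by rewrite ltrDl.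
near=> t.
have st : T1 + 1 <= t by near: t; apply: nbhs_pinfty_ge; rewrite num_real.
have t1 : 1 <= t by near: t; apply: nbhs_pinfty_ge; rewrite num_real.
(* The constant [n (T1 + 1)] is eventually below [e t / 2], hence below [e t^c / 2] since [c >= 1];
   dividing by [t^c] costs the second half of [e]. *)
have nt : n (T1 + 1) <= e / 2 * t.
  have e20 : 0 < e / 2 by rewrite divr_gt0.
  rewrite -(ler_pdivrMl _ _ e20).
  by near: t; apply: nbhs_pinfty_ge; rewrite num_real.
have tc := le1r_powR t1 c1.
have tp : 0 < t `^ c by rewrite powR_gt0 // (lt_le_trans _ t1).
have := ndec _ _ Ts st; rewrite {1}/n.
rewrite -subr_ge0 opprK => h.
rewrite -subr_ge0 -(pmulr_rge0 _ tp).
have : n (T1 + 1) <= e / 2 * t `^ c.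
  by rewrite (le_trans nt) // ler_pM2l ?divr_gt0.
by move: h; nra.
Unshelve. all: by end_near. Qed.
End half_line.

(** [W] integrates [f] over []t0, t]], so it lies between [0] and the total integral; for [t <= t0]
    the domain is empty, so the bounds hold for every [t]. This turns integrability into a bounded
    differentiable correction for the energy. *)
Lemma bounded_primitive (R : realType) (f : R -> R) (t0 : R) :
  {in `]t0, +oo[, continuous f} -> (forall t, t0 < t -> 0 <= f t) ->
  (\int[lebesgue_measure]_(t in `[t0, +oo[) (f t)%:E < +oo)%E ->
  exists W (M : R), (forall t, t0 < t -> is_derive t 1 W (f t)) /\
    (forall t, 0 <= W t <= M).
Proof.
move=> fc f0.
pose mu := @lebesgue_measure R.
have f0' : forall t, `]t0, +oo[%classic t -> (0 <= (f t)%:E)%E.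
  by move=> t; rewrite /= in_itv /= andbT lee_fin; exact: f0.
have fm : measurable_fun `]t0, +oo[%classic f.
  apply: open_continuous_measurable_fun; first exact: interval_open.
  by move=> t; rewrite inE => /fc.
(* The endpoint is a null set; without it [f] is continuous on the domain, hence measurable. *)
rewrite -integral_itv_obnd_cbnd; last exact/measurable_EFinP.
move=> fI.
have fi : mu.-integrable `]t0, +oo[%classic (EFin \o f).
  apply/integrableP; split; first exact/measurable_EFinP.
  apply: le_lt_trans fI; rewrite le_eqVlt; apply/orP; left; apply/eqP.
  by apply: eq_integral => t; rewrite inE => /f0'; exact: gee0_abs.
have fit t : mu.-integrable `]t0, t] (EFin \o f).
  apply: integrableS fi => //; apply: subset_itvl; by rewrite bnd_simp.
exists (fun t => \int[mu]_(s in `]t0, t]) f s).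
exists (fine (\int[mu]_(t in `]t0, +oo[) (f t)%:E)); split.
  move=> t t0t; have ft : {for t, continuous f}.
    by apply: fc; rewrite in_itv /= t0t.
  have tt : t < t + 1 by rewrite ltrDl.
  have [|Wd We] := @continuous_FTC1 R f (BRight t0) t _ tt (fit _) _ ft.
    by [].
  by split => //; rewrite -derive1E.
move=> t; apply/andP; split.
  by apply: Rintegral_ge0 => s; rewrite /= in_itv /= => /andP[? _]; exact: f0.
rewrite /Rintegral fine_le //.
- exact: integrable_fin_num.
- exact: integrable_fin_num.
- apply: ge0_subset_integral => //.
  + by case/integrableP: fi.
  + by apply: subset_itvl; rewrite bnd_simp.
Qed.

(** By the mean value theorem on [[t / 2, t]], the increment of [W], at most [M], equals
    [r eps(r) t / 2] for some [r] there, and [r eps(r) >= (t / 2) eps(t)]. The condition [2 t0 < t]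
    keeps [t / 2] beyond [t0]. *)
Lemma nonincreasing_le_inv_sqr (R : realType) (eps W : R -> R) (M t0 : R) :
  0 < t0 -> 
  (forall s t, t0 <= s -> s <= t -> eps t <= eps s) ->
  (forall t, t0 < t -> is_derive t 1 W (t * eps t)) ->
  (forall t, 0 <= W t <= M) ->
  forall t, 2 * t0 < t -> t ^+ 2 * eps t <= 4 * M.
Proof.
move=> t00 en Wd WM t tt.
have t2 : t0 < t / 2 by rewrite ltr_pdivlMr // mulrC.
have [|r [t0r /andP[rs rt]] e] :=
  is_derive_mvt _ _ _ _ _ Wd t2 (_ : t / 2 <= t).
  by rewrite ler_pdivrMr // ler_peMr //; lra.
have := WM t; have := WM (t / 2); have := en _ _ (ltW t0r) rt.
have [et|et] := lerP 0 (eps t); last first.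
  by move=> _ /andP[? ?] /andP[? ?]; have := sqr_ge0 t; nra.
move=> er /andP[W1 W2] /andP[W3 W4].
have : t / 2 * eps t * (t - t / 2) <= M.
  apply: (@le_trans _ _ (r * eps r * (t - t / 2))); last by rewrite -e; lra.
  rewrite ler_wpM2r //; first by lra.
  by rewrite ler_pM //; lra.
by move=> h; rewrite expr2; lra.
Qed.

(** * The energy along a trajectory *)

Section energy.
Context {R : realType} {H : normedModType R} {dot : {dot H for idfun}}.
Hypothesis hdot : induces_norm dot.
Variables (alpha beta : R) (z : H) (G eps : R -> R) (x v f : R -> H).

Let y t := v t + beta *: f t.

(* [energy b] is the energy of the header with its square expanded. *)
Definition energyA t := (t * t + (alpha - 2) * beta * t) * G t
  + t * t * eps t / 2 * dot (x t) (x t) + t * t / 2 * dot (y t) (y t).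

Definition energyB t := - (beta * t) * G t
  + (alpha - 1) / 2 * dot (x t - z) (x t - z) + t * dot (x t - z) (y t).

(** The terms in [b^2] from the square and from [b (alpha - 1 - b) |x - z|^2 / 2] cancel, so
    [energyB] is a slope in [b]. *)
Definition energy b t := energyA t + b * energyB t.

Definition denergy (deps : R -> R) b t :=
  let q := dot (f t) (x t - z) in
  (2 * t + (alpha - 2 - b) * beta) * G t
  - (alpha - 1 - b) * t * dot (v t) (v t) - b * (t - beta) * q
  - (t - beta) * t * beta * dot (f t) (f t)
  + (t * eps t + t * t * deps t / 2) * dot (x t) (x t)
  - t * eps t * b * dot (x t) (x t - z)
  - t * t * eps t * beta * dot (x t) (f t).

(** The equation gives [y' = - ((alpha / t) v + f + eps x)], free of the acceleration and of the
    Hessian term; this is why the energy is built on [y] rather than on [v]. *)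
Lemma is_derive_energy (deps : R -> R) (w h : R -> H) (b t : R) :
  t != 0 ->
  is_derive t 1 G (dot (f t) (v t)) -> is_derive t 1 eps (deps t) ->
  is_derive t 1 x (v t) -> is_derive t 1 v (w t) -> is_derive t 1 f (h t) ->
  w t + (alpha / t) *: v t + beta *: h t + f t + eps t *: x t = 0 ->
  is_derive t 1 (energy b) (denergy deps b t).
Proof.
move=> t0 dG deps' dx dv df ode.
have dy : is_derive t 1 y (- ((alpha / t) *: v t + f t + eps t *: x t)).
  apply: is_derive_eq; apply/eqP; rewrite -subr_eq0 opprK -[X in _ == X]ode.
  by apply/eqP; rewrite !addrA; congr (_ + _ + _); rewrite addrAC.
have dxz : is_derive t 1 (fun s => x s - z) (v t).
  by apply: is_derive_eq; rewrite subr0.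
have dXX := is_derive_dot hdot _ _ _ _ _ dx dx.
have dYY := is_derive_dot hdot _ _ _ _ _ dy dy.
have dZZ := is_derive_dot hdot _ _ _ _ _ dxz dxz.
have dZY := is_derive_dot hdot _ _ _ _ _ dxz dy.
rewrite /energy /energyA /energyB; apply: is_derive_eq.
rewrite /GRing.scale /= /denergy /y !dotE.
rewrite (dotC (f t) (v t)) (dotC (x t) (v t)) (dotC (x t) (f t)).
rewrite (dotC z (v t)) (dotC z (f t)) (dotC (x t) z).
by field.
Qed.

(** After [G] is replaced by [q = <f, x - z>], the terms in [q] without [eps] add up to
    [- (b - 2) t q + (alpha - 2) beta q], and half of the first absorbs the second for large [t].
    The cross terms with [eps] are handled by completing squares. *)
Lemma denergy_le (deps : R -> R) (a b t : R) : 2 < b -> b < alpha - 1 ->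
  0 <= beta -> 1 <= t -> 2 * beta <= t ->
  2 * (alpha - 2) * beta <= (b - 2) * t ->
  0 <= G t -> G t <= dot (f t) (x t - z) -> 0 <= eps t -> deps t <= 0 ->
  t * t * eps t <= a ->
  denergy deps b t <= (b + beta * a) / 2 * dot z z * (t * eps t)
    - (b - 2) / 2 * t * dot (f t) (x t - z).
Proof.
move=> b2 ba be0 t1 tb tab G0 Gq e0 de0 ta.
have t0 : 0 <= t by exact: le_trans t1.
have h1 : 0 <= (2 * t + (alpha - 2 - b) * beta) * (dot (f t) (x t - z) - G t).
  by rewrite mulr_ge0 ?subr_ge0 //; nra.
have h2 : 0 <= (alpha - 1 - b) * t * dot (v t) (v t).
  by rewrite !mulr_ge0 ?(dot_ge0 hdot) //; lra.
have h3 : 0 <= t * t * (- deps t) * dot (x t) (x t).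
  by rewrite !mulr_ge0 ?(dot_ge0 hdot) // oppr_ge0.
(* Together with [h5] this uses [2 <x, x - z> = |x|^2 + |x - z|^2 - |z|^2]; as [b > 2], only
   [(b / 2) |z|^2 t eps] survives. *)
have h4 : 0 <= t * eps t * (b / 2) * dot (x t - z) (x t - z).
  by rewrite !mulr_ge0 ?(dot_ge0 hdot) //; lra.
have h5 : 0 <= t * eps t * (b / 2 - 1) * dot (x t) (x t).
  by rewrite !mulr_ge0 ?(dot_ge0 hdot) //; lra.
(* Half of this square bounds [- t^2 eps beta <z, f>], what remains of the last term of [denergy]
   once [h9] has removed its [x - z] part; [h7] pays for the resulting [t^2 beta |f|^2 / 2]. *)
have h6 : 0 <= t * t * beta * dot (f t + eps t *: z) (f t + eps t *: z).
  by rewrite !mulr_ge0 ?(dot_ge0 hdot) //; lra.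
have h7 : 0 <= t * (t / 2 - beta) * beta * dot (f t) (f t).
  by rewrite !mulr_ge0 ?(dot_ge0 hdot) //; lra.
have q0 := le_trans G0 Gq.
have h8 : 0 <= ((b - 2) / 2 * t - (alpha - 2) * beta) * dot (f t) (x t - z).
  by rewrite mulr_ge0 //; lra.
have h9 : 0 <= t * t * eps t * beta * dot (f t) (x t - z).
  by rewrite !mulr_ge0.
have a0 : 0 <= a by apply: le_trans ta; rewrite !mulr_ge0.
(* Turns the remaining [t^2 eps^2 |z|^2] into a multiple of [t eps], by [t^2 eps <= a <= a t]. *)
have h10 : 0 <= beta * dot z z * eps t * (a * t - t * t * eps t).
  by rewrite !mulr_ge0 ?(dot_ge0 hdot) // subr_ge0 (le_trans ta) // ler_peMr.
rewrite -subr_ge0 /denergy.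
move: h1 h2 h3 h4 h5 h6 h7 h8 h9 h10; rewrite !dotE.
rewrite (dotC (x t) (f t)) (dotC z (f t)) (dotC (x t) z).
lra.
Qed.
End energy.

Lemma cvg0_le_inv (R : realType) (u : R -> R) (C T : R) :
  (forall t, T < t -> `|u t| <= C / t) -> u t @[t --> +oo] --> 0.
Proof.
move=> uC; apply/cvgr0Pnorm_le => e e0.
near=> t.
have Tt : T < t by near: t; apply: nbhs_pinfty_gt; rewrite num_real.
have t0 : 0 < t by near: t; apply: nbhs_pinfty_gt; rewrite num_real.
have Ct : C / e <= t by near: t; apply: nbhs_pinfty_ge; rewrite num_real.
apply: le_trans (uC t Tt) _.
by rewrite ler_pdivrMr // mulrC -ler_pdivrMr.
Unshelve. all: by end_near. Qed.

Section energy_bounds.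
Context {R : realType} {H : normedModType R} {dot : {dot H for idfun}}.
Hypothesis hdot : induces_norm dot.
Variables (alpha beta : R) (z : H) (G eps : R -> R) (x v f : R -> H).

Local Notation E := (@energy R H dot alpha beta z G eps x v f).

(** Both squares are dropped, and half of [t^2 G] absorbs [(alpha - 2 - b) beta t G], since
    [alpha - 2 - b > -1] and [t >= 2 beta]. *)
Lemma energy_ge (b t : R) : 2 < b -> b < alpha - 1 -> 0 <= beta -> 0 <= t ->
  2 * beta <= t -> 0 <= G t -> 0 <= eps t ->
  t * t / 2 * G t + b * (alpha - 1 - b) / 2 * dot (x t - z) (x t - z)
    <= E b t.
Proof.
move=> b2 ba be0 t0 tb G0 e0.
have h1 : 0 <= (t * (t / 2 + (alpha - 2 - b) * beta)) * G t.
  by rewrite !mulr_ge0 //; nra.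
have h2 : 0 <= t * t * eps t / 2 * dot (x t) (x t).
  by rewrite !mulr_ge0 ?(dot_ge0 hdot).
have := dot_ge0 hdot (b *: (x t - z) + t *: (v t + beta *: f t)).
move=> h3; rewrite -subr_ge0 /energy /energyA /energyB; move: h1 h2 h3.
move: (v t + _) (x t - z) => y w.
by rewrite !dotE (dotC y w); lra.
Qed.

End energy_bounds.

(** * Monotonicity, decay and limits along the trajectory *)

Section trajectory.
Context {R : realType} {H : normedModType R} {dot : {dot H for idfun}}.
Hypothesis hdot : induces_norm dot.
Variables (alpha beta a M T : R) (z : H) (G eps deps W : R -> R).
Variables (x v w f h : R -> H).
Hypotheses (alpha3 : 3 < alpha) (beta0 : 0 <= beta) (T0 : 0 < T).
Hypothesis dG : forall t, T < t -> is_derive t 1 G (dot (f t) (v t)).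
Hypothesis eps_deriv : forall t, T < t -> is_derive t 1 eps (deps t).
Hypothesis dx : forall t, T < t -> is_derive t 1 x (v t).
Hypothesis dv : forall t, T < t -> is_derive t 1 v (w t).
Hypothesis df : forall t, T < t -> is_derive t 1 f (h t).
Hypothesis dW : forall t, T < t -> is_derive t 1 W (t * eps t).
Hypothesis ode : forall t, T < t ->
  w t + (alpha / t) *: v t + beta *: h t + f t + eps t *: x t = 0.
Hypothesis G_ge0 : forall t, T < t -> 0 <= G t.
Hypothesis G_le : forall t, T < t -> G t <= dot (f t) (x t - z).
Hypothesis eps_ge0 : forall t, T < t -> 0 <= eps t.
Hypothesis deps_le0 : forall t, T < t -> deps t <= 0.
Hypothesis eps_le : forall t, T < t -> t * t * eps t <= a.
Hypothesis W_bnd : forall t, 0 <= W t <= M.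

Local Notation E := (@energy R H dot alpha beta z G eps x v f).

(** Since [W' = t eps(t)], the subtracted term cancels the integrable error in [denergy_le], which
    makes this quantity eventually nonincreasing. *)
Definition renormalized_energy b t :=
  E b t - (b + beta * a) / 2 * dot z z * W t.

Local Notation Gamma := renormalized_energy.

(** Beyond this time all the largeness conditions of [denergy_le] hold. *)
Definition decay_time b :=
  Num.max (Num.max T 1) (Num.max (2 * beta) (2 * (alpha - 2) * beta / (b - 2))).

Lemma decay_time_lt b t : 2 < b -> decay_time b < t ->
  [/\ T < t, 1 <= t, 2 * beta <= t & 2 * (alpha - 2) * beta <= (b - 2) * t].
Proof.
move=> b2; rewrite /decay_time !gt_max.
move=> /andP[/andP[-> /ltW ->] /andP[/ltW ->]].
by rewrite ltr_pdivrMr ?subr_gt0 // (mulrC t) => /ltW ->.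
Qed.

Section fixed_b.
Variables (b : R).
Hypotheses (b2 : 2 < b) (ba : b < alpha - 1).

Lemma a_ge0 : 0 <= a.
Proof.
have TT : T < T + 1 by rewrite ltrDl.
apply: le_trans (eps_le _ TT); rewrite !mulr_ge0 ?eps_ge0 //.
all: by rewrite addr_ge0 // ltW.
Qed.

Lemma is_derive_renormalized : exists dg : R -> R, forall t, decay_time b < t ->
  is_derive t 1 (Gamma b) (dg t) /\
  dg t <= - ((b - 2) / 2 * t * dot (f t) (x t - z)).
Proof.
suff hd : forall t, exists dg, decay_time b < t -> is_derive t 1 (Gamma b) dg /\
    dg <= - ((b - 2) / 2 * t * dot (f t) (x t - z)).
  by have [dg hdg] := choice hd; exists dg.
move=> t; have [tb|] := ltP (decay_time b) t; last by exists 0.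
move: tb => /(decay_time_lt _ _ b2)[Tt t1 tb tab].
have t0 : t != 0 by rewrite gt_eqF // (lt_trans T0).
have dE := is_derive_energy hdot _ _ z _ _ _ _ _ _ _ _ b _ t0 (dG _ Tt)
  (eps_deriv _ Tt) (dx _ Tt) (dv _ Tt) (df _ Tt) (ode _ Tt).
have dW' := dW _ Tt.
exists (@denergy R H dot alpha beta z G eps x v f deps b t -
  (b + beta * a) / 2 * dot z z * (t * eps t)) => _; split.
  rewrite /renormalized_energy; apply: is_derive_eq.
  by rewrite /GRing.scale /=; ring.
have := denergy_le hdot _ _ z G eps x v f deps a _ t b2 ba beta0 t1 tb tab
  (G_ge0 _ Tt) (G_le _ Tt) (eps_ge0 _ Tt) (deps_le0 _ Tt) (eps_le _ Tt).
by lra.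
Qed.

Lemma renormalized_noninc s t : decay_time b < s -> s <= t ->
  Gamma b t <= Gamma b s.
Proof.
have [dg hdg] := is_derive_renormalized.
apply: (is_derive_le0 _ dg) => r rb; first by have [] := hdg r rb.
have [Tr r1 _ _] := decay_time_lt _ _ b2 rb.
have q0 := le_trans (G_ge0 _ Tr) (G_le _ Tr).
have r0 : 0 <= r by exact: le_trans r1.
have b0 : 0 <= b - 2 by rewrite subr_ge0 ltW.
by apply: le_trans (hdg r rb).2 _; rewrite oppr_le0 !mulr_ge0.
Qed.

Let K := (b + beta * a) / 2 * dot z z.

Let K_ge0 : 0 <= K.
Proof.
rewrite /K !mulr_ge0 ?(dot_ge0 hdot) // addr_ge0 ?mulr_ge0 ?a_ge0 //.
by move: b2; lra.
Qed.

Lemma energy_ge0 t : decay_time b < t -> 0 <= E b t.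
Proof.
move=> /(decay_time_lt _ _ b2)[Tt t1 tb tab].
have t0 : 0 <= t by exact: le_trans t1.
apply: le_trans (energy_ge hdot _ _ z _ _ _ _ _ _ _ b2 ba beta0 t0 tb
  (G_ge0 _ Tt) (eps_ge0 _ Tt)).
rewrite addr_ge0 // !mulr_ge0 ?(dot_ge0 hdot) ?G_ge0 //; by move: b2 ba; lra.
Qed.

Lemma renormalized_ge t : decay_time b < t -> - (K * M) <= Gamma b t.
Proof.
move=> /energy_ge0 E0; rewrite /renormalized_energy -/K.
by have /andP[_ WM] := W_bnd t; have := ler_wpM2l K_ge0 WM; lra.
Qed.

Lemma renormalized_cvg : cvg (Gamma b t @[t --> +oo]).
Proof.
exact: nonincreasing_near_cvgr renormalized_noninc renormalized_ge.
Qed.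

Lemma energy_bounded : exists C, forall t, decay_time b + 1 < t ->
  E b t <= C.
Proof.
exists (Gamma b (decay_time b + 1) + K * M) => t /ltW tt.
have bb : decay_time b < decay_time b + 1 by rewrite ltrDl.
have := renormalized_noninc _ _ bb tt; rewrite {1}/renormalized_energy -/K.
by have /andP[_ WM] := W_bnd t; have := ler_wpM2l K_ge0 WM; lra.
Qed.

Lemma W_cvg : cvg (W t @[t --> +oo]).
Proof.
have Wle s t : T < s -> s <= t -> - W t <= - W s.
  apply: (is_derive_le0 (fun t => - W t) (fun t => - (t * eps t)) T) => r Tr.
    by have := dW _ Tr => ?; exact: is_deriveN.
  by rewrite oppr_le0 mulr_ge0 ?eps_ge0 // ltW // (lt_trans T0).
have /cvg_ex[l /cvgN hl] : cvg (- W t @[t --> +oo]).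
  apply: (nonincreasing_near_cvgr _ T (- M) Wle) => t _.
  by rewrite lerN2; have /andP[] := W_bnd t.
apply/cvg_ex; exists (- l).
by under eq_fun do rewrite -[W _]opprK.
Qed.

Lemma energy_cvg : cvg (E b t @[t --> +oo]).
Proof.
have /cvg_ex[l hl] := renormalized_cvg; have /cvg_ex[m hm] := W_cvg.
apply/cvg_ex; exists (l + K * m).
rewrite (_ : E b = fun t => Gamma b t + K * W t); last first.
  by apply/funext => t; rewrite /renormalized_energy subrK.
by apply: cvgD => //; apply: cvgM => //; exact: cvg_cst.
Qed.

End fixed_b.
Lemma residual_le_inv :
  exists C T1, forall t, T1 < t -> 0 < t /\ t * G t <= C / t.
Proof.
(* The midpoint of []2, alpha - 1[], an interval that is nonempty because [alpha > 3]. *)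
pose b := 2 + (alpha - 3) / 2.
have b2 : 2 < b by rewrite /b; move: alpha3; lra.
have ba : b < alpha - 1 by rewrite /b; move: alpha3; lra.
have [C hC] := energy_bounded b b2 ba.
exists (2 * C), (decay_time b + 1) => t tt.
have dt : decay_time b < t by rewrite (lt_trans _ tt) // ltrDl.
have [Tt t1 tb _] := decay_time_lt b t b2 dt.
have t0 : 0 < t by exact: lt_le_trans t1.
split => //; rewrite ler_pdivlMr //.
have := energy_ge hdot _ _ z _ _ x v f _ _ b2 ba beta0 (ltW t0) tb
  (G_ge0 _ Tt) (eps_ge0 _ Tt).
have : 0 <= b * (alpha - 1 - b) / 2 * dot (x t - z) (x t - z).
  by rewrite !mulr_ge0 ?(dot_ge0 hdot) //; lra.
by have := hC t tt; lra.
Qed.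

Lemma residual_cvg0 : G t @[t --> +oo] --> 0.
Proof.
have [C [T1 hC]] := residual_le_inv.
apply: (cvg0_le_inv _ _ C (Num.max (Num.max T 1) T1)) => t.
rewrite !gt_max => /andP[/andP[Tt t1] /hC[t0]].
rewrite ger0_norm ?G_ge0 //; apply: le_trans.
by rewrite ler_peMl ?G_ge0 // ltW.
Qed.

(* [energy b] is affine in [b], so the convergence of two energies gives that
   of [energyB]. *)
Lemma momentum_cvg : exists L : R,
  ((alpha - 1) / 2 * dot (x t - z) (x t - z) + t * dot (v t) (x t - z)
    + beta * t * dot (f t) (x t - z) : R) @[t --> +oo] --> L.
Proof.
(* A third of the length of []2, alpha - 1[], so that [2 + d] and [2 + 2 d] are two admissible
   parameters. *)
pose d := (alpha - 3) / 3.
have d0 : 0 < d by rewrite /d; move: alpha3; lra.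
have /cvg_ex[l1 hl1] : cvg (E (2 + d) t @[t --> +oo]).
  by apply: energy_cvg; rewrite /d; move: alpha3; lra.
have /cvg_ex[l2 hl2] : cvg (E (2 + 2 * d) t @[t --> +oo]).
  by apply: energy_cvg; rewrite /d; move: alpha3; lra.
have tG : t * G t @[t --> +oo] --> 0.
  have [C [T1 hC]] := residual_le_inv.
  apply: (cvg0_le_inv _ _ C (Num.max T T1)) => t.
  rewrite gt_max => /andP[Tt /hC[t0]].
  by rewrite ger0_norm // mulr_ge0 ?G_ge0 // ltW.
(* The quotient is the limit of [energyB]; the other summand restores its term [- beta t G], which
   vanishes in the limit. *)
exists ((l2 - l1) / d + beta * 0).
rewrite (_ : (fun t => _) = fun t =>
    (E (2 + 2 * d) t - E (2 + d) t) / d + beta * (t * G t)).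
  apply: cvgD; apply: cvgM => //; try exact: cvg_cst.
  exact: cvgB.
apply/funext => t; rewrite /energy /energyB.
rewrite (dotC (v t)) (dotC (f t)) (dotDr (v t)) dotZr.
by field; rewrite gt_eqF.
Qed.

(** Two one-sided uses of [cvg_euler_ge] on the limit in [momentum_cvg]: for [- hh], the nonnegative
    summand [beta t <f, x - z>] is simply dropped; for [hh], it has to be compensated. *)
Lemma half_sqr_dist_cvg : cvg (dot (x t - z) (x t - z) / 2 @[t --> +oo]).
Proof.
have [L hL] := momentum_cvg.
pose hh t := dot (x t - z) (x t - z) / 2.
have dhh t : T < t -> is_derive t 1 hh (dot (v t) (x t - z)).
  move=> Tt; have dx' := dx _ Tt.
  have dxz : is_derive t 1 (fun s => x s - z) (v t).
    by apply: is_derive_eq; rewrite subr0.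
  have dZZ := is_derive_dot hdot _ _ _ _ _ dxz dxz.
  rewrite /hh; apply: is_derive_eq.
  by rewrite /GRing.scale /= (dotC (x t - z) (v t)); field.
have c1 : 1 <= alpha - 1 by move: alpha3; lra.
have q0 t : T < t -> 0 <= dot (f t) (x t - z).
  by move=> Tt; exact: le_trans (G_ge0 _ Tt) (G_le _ Tt).
apply/cvg_ex; exists (L / (alpha - 1)).
apply/cvgrPdist_le => e e0.
have upper : \forall t \near +oo, - L / (alpha - 1) - e <= - hh t.
  apply: (cvg_euler_ge _ (fun t => - dot (v t) (x t - z)) _ T _ _ _ c1 e0);
    last exact: cvgN hL.
  - by move=> t Tt; have := dhh t Tt => ?; exact: is_deriveN.
  - move=> t Tt /=; rewrite /hh.
    have t0 : 0 < t := lt_trans T0 Tt.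
    have : 0 <= beta * t * dot (f t) (x t - z) by rewrite !mulr_ge0 ?q0 // ltW.
    lra.
pose b := 2 + (alpha - 3) / 2; pose c := (b - 2) / 2.
have b2 : 2 < b by rewrite /b; move: alpha3; lra.
have ba : b < alpha - 1 by rewrite /b; move: alpha3; lra.
have c0 : 0 < c by rewrite /c; lra.
have Gt0 k : k * (Gamma b t / t) @[t --> +oo] --> 0.
  have /cvg_ex[l hl] := renormalized_cvg b b2 ba.
  have hi : t^-1 @[t --> +oo] --> (0 : R).
    apply: (cvg0_le_inv _ _ 1 0) => t t0.
    by rewrite div1r ger0_norm // invr_ge0 ltW.
  have -> : 0 = k * (l * 0) :> R by rewrite !mulr0.
  by apply: cvgM; [exact: cvg_cst|exact: cvgM].
(* The dissipation [Gamma' <= - c t <f, x - z>] compensates the last summand of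
   [hL]: subtracting [(beta / c) Gamma / t] from [hh] costs nothing in the
   limit, as [Gamma] is bounded. *)
have lower : \forall t \near +oo,
    L / (alpha - 1) - e / 2 <= hh t - beta / c * (Gamma b t / t).
  have [dg hdg] := is_derive_renormalized b b2 ba.
  have e20 : 0 < e / 2 by rewrite divr_gt0.
  (* For [m = hh - (beta / c) Gamma / t], the expression [(alpha - 1) m + t m'] produces [- (alpha -
     2) (beta / c) Gamma / t - (beta / c) Gamma'], and the last term is at least
     [beta t <f, x - z>]. *)
  pose r t := (alpha - 1) / 2 * dot (x t - z) (x t - z)
    + t * dot (v t) (x t - z) + beta * t * dot (f t) (x t - z)
    - (alpha - 2) * (beta / c) * (Gamma b t / t).
  have hr : r t @[t --> +oo] --> L.
    by rewrite -[L]subr0; apply: cvgB.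
  apply: (cvg_euler_ge _ (fun t => dot (v t) (x t - z)
      - beta / c * (dg t / t - Gamma b t / (t * t))) r (decay_time b)
      _ _ _ c1 e20 _ _ hr).
  - move=> t bt; have [Tt t1 _ _] := decay_time_lt _ _ b2 bt.
    have dh := dhh _ Tt; have [dGa _] := hdg t bt.
    have tn0 : t != 0 by rewrite gt_eqF // (lt_trans T0).
    have dV : is_derive t 1 (fun s : R => s^-1) (- (t * t)^-1).
      have := @is_deriveV R id t 1 1 tn0 (is_derive_id _ _).
      by rewrite /GRing.scale /= mulr1 expr2.
    apply: is_derive_eq; rewrite /GRing.scale /=; field.
    by rewrite tn0 gt_eqF.
  - move=> t bt; have [Tt t1 _ _] := decay_time_lt _ _ b2 bt.
    have [_ dle] := hdg t bt; rewrite /r /hh -/c in dle *.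
    have tp : 0 < t := lt_trans T0 Tt.
    rewrite -subr_ge0.
    rewrite [leRHS](_ : _ =
      beta / c * (- (c * t * dot (f t) (x t - z)) - dg t)).
      by rewrite mulr_ge0 ?subr_ge0 // divr_ge0 // ltW.
    by field; rewrite !gt_eqF.
have small : \forall t \near +oo, `|beta / c * (Gamma b t / t)| <= e / 2.
  by move/cvgr0Pnorm_le : (Gt0 (beta / c)); apply; rewrite divr_gt0.
near=> t.
have ht : - L / (alpha - 1) - e <= - hh t by near: t.
have kt : L / (alpha - 1) - e / 2 <= hh t - beta / c * (Gamma b t / t).
  by near: t.
have st : `|beta / c * (Gamma b t / t)| <= e / 2 by near: t.
rewrite ler_distlC; move: st; rewrite ler_norml => /andP[s1 s2].
rewrite mulNr in ht.
rewrite -/(hh t); apply/andP; split; lra.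
Unshelve. all: by end_near. Qed.

Lemma dist_cvg : cvg (`|x t - z| @[t --> +oo]).
Proof.
have /cvg_ex[l hl] := half_sqr_dist_cvg.
apply/cvg_ex; exists (Num.sqrt (2 * l)).
rewrite (_ : (fun t => _) =
    fun t => Num.sqrt (2 * (dot (x t - z) (x t - z) / 2))).
  have h2l : 2 * (dot (x t - z) (x t - z) / 2) @[t --> +oo] --> 2 * l.
    by apply: cvgM => //; exact: cvg_cst.
  apply: continuous_cvg; [exact: sqrt_continuous|exact: h2l].
by apply/funext => t; rewrite hdot mulrC divfK // sqrtr_sqr normr_id.
Qed.

End trajectory.

(** * Chain rule, sign of the derivative, and weak convergence of the solution *)

Lemma is_derive_diff_comp (R : realType) (V W : normedModType R) (F : V -> W)
    (x : R -> V) (t : R) (v : V) :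
  differentiable F (x t) -> is_derive t 1 x v ->
  is_derive t 1 (fun s => F (x s)) ('d F (x t) v).
Proof.
move=> Fd [xd xv].
have xD : differentiable x t by exact/derivable1_diffP.
have FxD : differentiable (F \o x) t by exact: differentiable_comp.
split; first exact: diff_derivable.
by rewrite (deriveE _ FxD) diff_comp //= -xv deriveE.
Qed.

Lemma nonincreasing_derive_le0 (R : realType) (f : R -> R) (t0 t df : R) :
  (forall r s, t0 <= r -> r <= s -> f s <= f r) -> t0 <= t ->
  is_derive t 1 f df -> df <= 0.
Proof.
move=> fn t0t [fd <-]; have dl := cvg_dnbhs_at_right fd.
apply: (cvgr_to_le dl); near=> h => /=.
have h0 : 0 < h by near: h; exact: nbhs_right_gt.
rewrite /GRing.scale /= mulr1 pmulr_rle0 ?invr_gt0 // subr_le0.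
by apply: fn => //; rewrite lerDr ltW.
Unshelve. all: by end_near. Qed.

Theorem theorem3p5 (R : realType) (H : completeNormedModType R)
    (dot : {dot H for idfun}) (hdot : induces_norm dot)
    (g : H -> R) (eps : R -> R) (alpha beta t0 : R) (u0 v0 : H) (x : R -> H)
    (g_convex : convex_function [set: H] g)
    (g_diff2 : twice_differentiable dot g)
    (g_lip : lipschitz_on_bounded (gradient dot g))
    (g_argmin : argmin g !=set0)
    (eps_ge0 : forall t, t0 <= t -> 0 <= eps t)
    (eps_noninc : forall s t, t0 <= s -> s <= t -> eps t <= eps s)
    (eps_C1 : C1_on [set` `[t0, +oo[] eps)
    (eps_lim : eps t @[t --> +oo] --> (0 : R))
    (beta_ge0 : 0 <= beta)
    (t0_gt0 : 0 < t0)
    (x_sol : is_C2_solution dot g eps alpha beta t0 u0 v0 x)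
    (eps_int : (\int[lebesgue_measure]_(t in `[t0, +oo[) (t * eps t)%:E
                  < +oo)%E)
    (eps_cond :
      (exists a t1 : R, [/\ 1 < a, t0 <= t1 &
         forall t, t1 <= t ->
           derive_within [set` `[t0, +oo[] eps t
             <= - (a * beta / 2) * eps t ^+ 2])
      \/
      (exists a t1 : R, [/\ 0 < a, t0 <= t1 &
         forall t, t1 <= t -> eps t <= a / t]))
    (alpha_gt3 : 3 < alpha) :
  exists2 z : H, argmin g z & weakly_cvg dot (x t @[t --> +oo]) z.
Proof.
have [g_diff grad_diff] := g_diff2.
have [[x_der [v_der _]] ode _ _] := x_sol.
set D := [set` _] in x_der v_der ode.
pose v := derive_within D x; pose w := derive_within D v.
pose f t := gradient dot g (x t); pose deps := derive_within D eps.
have deps_is t : t0 < t -> is_derive t 1 eps (deps t).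
  by apply: is_derive_within; exact: eps_C1.1.
have dx t : t0 < t -> is_derive t 1 x (v t) by exact: is_derive_within.
have dv t : t0 < t -> is_derive t 1 v (w t) by exact: is_derive_within.
have [W [M [dW W_bnd]]] : exists (W : R -> R) (M : R),
    (forall t, t0 < t -> is_derive t 1 W (t * eps t)) /\
    (forall t, 0 <= W t <= M).
  apply: bounded_primitive eps_int => t.
    rewrite in_itv /= andbT => t0t; have ? := deps_is _ t0t.
    apply/differentiable_continuous/derivable1_diffP.
    have : is_derive t 1 (fun s => s * eps s) (t * deps t + eps t).
      by apply: is_derive_eq; rewrite /GRing.scale /= mulr1.
    by case.
  by move=> t0t; rewrite mulr_ge0 ?eps_ge0 // ltW // (lt_trans t0_gt0).
(* Beyond [2 t0] the bound [t^2 eps(t) <= 4 M] is available. *)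
pose T := 2 * t0.
have T0 : 0 < T by rewrite mulr_gt0.
have Tt t : T < t -> t0 < t.
  by apply: le_lt_trans; rewrite ler_peMl ?ler1n // ltW.
(* The energy argument is run for every minimizer [z], as Opial's lemma asks for the convergence of
   the distance to each of them. *)
have main z : argmin g z ->
    g (x t) - g z @[t --> +oo] --> 0 /\ cvg (`|x t - z| @[t --> +oo]).
  move=> gz; pose G t := g (x t) - g z.
  have dG t : T < t -> is_derive t 1 G (dot (f t) (v t)).
    move=> /Tt t0t; rewrite -(dot_gradient hdot) //.
    have ? := is_derive_diff_comp _ _ _ _ _ _ _ (g_diff (x t)) (dx _ t0t).
    by apply: is_derive_eq; rewrite subr0.
  have df t : T < t -> is_derive t 1 f (hessian dot g (x t) (v t)).
    move=> /Tt t0t.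
    exact: is_derive_diff_comp (grad_diff (x t)) (dx _ t0t).
  have G_ge0 t : T < t -> 0 <= G t by move=> _; rewrite subr_ge0.
  have G_le t : T < t -> G t <= dot (f t) (x t - z).
    move=> _; have := convex_gradient_le hdot g g_convex g_diff (x t) z.
    by rewrite -opprB dotNr -/(f t) /G; lra.
  have eps0 t : T < t -> 0 <= eps t by move=> /Tt /ltW; exact: eps_ge0.
  have deps0 t : T < t -> deps t <= 0.
    move=> /Tt t0t.
    exact: nonincreasing_derive_le0 eps_noninc (ltW t0t) (deps_is _ t0t).
  have eps_le t : T < t -> t * t * eps t <= 4 * M.
    rewrite -expr2.
    exact: nonincreasing_le_inv_sqr t0_gt0 eps_noninc dW W_bnd t.
  have ode' t : T < t -> w t + (alpha / t) *: v t
      + beta *: hessian dot g (x t) (v t) + f t + eps t *: x t = 0.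
    by move=> /Tt /ltW; exact: ode.
  split.
  - exact: (residual_cvg0 hdot alpha beta (4 * M) M T z G eps deps W x v w f _
      alpha_gt3 beta_ge0 T0 dG (fun t h => deps_is t (Tt t h))
      (fun t h => dx t (Tt t h)) (fun t h => dv t (Tt t h)) df
      (fun t h => dW t (Tt t h)) ode' G_ge0 G_le eps0 deps0 eps_le W_bnd).
  - exact: (dist_cvg hdot alpha beta (4 * M) M T z G eps deps W x v w f _
      alpha_gt3 beta_ge0 T0 dG (fun t h => deps_is t (Tt t h))
      (fun t h => dx t (Tt t h)) (fun t h => dv t (Tt t h)) df
      (fun t h => dW t (Tt t h)) ode' G_ge0 G_le eps0 deps0 eps_le W_bnd).
apply: (opial hdot) => // [z /main[]//|U UU FU c xc].
have [z gz] := g_argmin; have [gx _] := main _ gz.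
suff gcz : g c <= g z by move=> y; exact: le_trans gcz (gz y).
have gU : g (x t) @[t --> U] --> g z.
  rewrite (_ : (fun t => g (x t)) = fun t => g (x t) - g z + g z); last first.
    by apply/funext => t; rewrite subrK.
  rewrite -[X in _ --> X]add0r; apply: cvgD; last exact: cvg_cst.
  by apply: cvg_trans gx; exact: cvg_app.
(* Weak lower semicontinuity of [g]: the gradient inequality at [c] bounds [g c] by
   [g (x t) - <grad g(c), x t - c>], whose inner product vanishes along [U]. *)
have lU : g (x t) - (dot (x t) (gradient dot g c) - dot c (gradient dot g c))
    @[t --> U] --> g z.
  rewrite -[g z]subr0 -[in X in _ --> X](subrr (dot c (gradient dot g c))).
  by apply: cvgB => //; apply: cvgB; [exact: xc|exact: cvg_cst].
apply: (cvgr_to_ge lU); near=> t.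
have := convex_gradient_le hdot g g_convex g_diff c (x t).
by rewrite dotBr (dotC _ (x t)) (dotC _ c); lra.
Unshelve. all: by end_near. Qed.
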